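(* For a connected digraph $G$ of order $n\geq 2$, we have $\gamma_L(G)=n-1$ if and only if at least one of the following holds: (a) $n=3$; (b) $G$ is a directed star; (c) $V(G)$ can be partitioned into three (possibly empty) sets $S_1$, $C$ and $S_2$, such that $S_1$ and $S_2$ are independent sets, $C$ is a bidirected clique, and the remaining arcs in $G$ are all the possible arcs from $S_1$ to $C\cup S_2$ and those from $C$ to $S_2$.
   Context: Digraphs are loopless without multiple arcs. A dominating set of a digraph $G$ is a set $D$ such that every vertex not in $D$ has an in-neighbour in $D$; it is locating-dominating if moreover every vertex not in $D$ has a distinct set of in-neighbours in $D$. $\gamma_L(G)$ denotes the minimum size of a locating-dominating set of $G$. A directed star is a digraph with a special vertex belonging to all arcs and no isolated vertices. *)

(* Defs.v *)
From mathcomp Require Import all_boot.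
Set Implicit Arguments.
Unset Strict Implicit.
Unset Printing Implicit Defensive.

(* A digraph is a finType T of vertices with an irreflexive arc relation
   e : rel T; e u v means that there is an arc from u to v, and both e u v and
   e v u may hold. *)

Section Digraph.
Variables (T : finType) (e : rel T).
Implicit Types (D S C : {set T}) (u v : T).

Definition weakly_connected :=
  forall u v, connect [rel x y | e x y || e y x] u v.

Definition in_nbhd v : {set T} := [set u | e u v].

Definition dominating D :=
  [forall v, (v \notin D) ==> [exists u in D, e u v]].

Definition locating_dominating D :=
  dominating D &&
  [forall u, forall v, [&& u \notin D, v \notin D & u != v] ==>
     (in_nbhd u :&: D != in_nbhd v :&: D)].

Lemma locating_dominatingT : locating_dominating [set: T].
Proof.
by apply/andP; split; [apply/forallP=> v | apply/forallP=> u; apply/forallP=> v];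
  rewrite in_setT.
Qed.

Definition gammaL : nat :=
  #|[arg min_(D < [set: T] | locating_dominating D) #|D|]|.

Lemma gammaLP :
  (exists2 D, locating_dominating D & #|D| = gammaL) /\
  (forall D, locating_dominating D -> gammaL <= #|D|).
Proof.
rewrite /gammaL; case: arg_minnP => [|D ldD minD].
  exact: locating_dominatingT.
by split; [exists D | exact: minD].
Qed.

Definition directed_star :=
  (exists c, forall u v, e u v -> u = c \/ v = c) /\
  (forall u, exists v, e u v || e v u).

Definition independent S := forall u v, u \in S -> v \in S -> ~~ e u v.

Definition bidirected_clique C :=
  forall u v, u \in C -> v \in C -> u != v -> e u v.

Definition tripartition S1 C S2 :=
  [/\ S1 :|: C :|: S2 = [set: T],
      [disjoint S1 & C], [disjoint S1 & S2] & [disjoint C & S2]].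

(* The last clause describes the arcs that lie inside none of the three
   parts. *)
Definition layered S1 C S2 :=
  [/\ independent S1, independent S2, bidirected_clique C &
      forall u v,
        ~~ [|| (u \in S1) && (v \in S1), (u \in C) && (v \in C)
             | (u \in S2) && (v \in S2)] ->
        e u v = (u \in S1) && (v \in C :|: S2) || (u \in C) && (v \in S2)].

End Digraph.

(* Main.v *)
Require Import Defs.
From mathcomp Require Import all_boot.

(** Without isolated vertices, [gammaL e = #|T| - 1] means that the complement
of no pair [u, v] is locating-dominating, i.e. that one of [u], [v] has no
in-neighbour outside the pair, or both have the same ones ("twins").
If all vertices of positive in-degree are pairwise twins, the digraph is
layered: among them, a vertex dominates all the others or none of them.
Otherwise some vertex [a] has [c] as unique in-neighbour, while [c] has an
in-neighbour [w] other than [a].  Comparing [a] with any [x] other than [a]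
and [c] shows that all in-neighbours of [x] are [a] or [c].  Hence either [c]
is the centre of a star, or [a] has an out-neighbour [x] other than [c], and
then comparing [c] with [x] forces [w = x] and [#|T| = 3]. *)

Section LocatingDomination.
Variables (T : finType) (e : rel T).
Implicit Types (u v w : T) (D : {set T}).

(** * Inseparable pairs and the locating-domination number *)

Definition twins u v := forall w, w != u -> w != v -> e w u = e w v.

Definition inseparable u v :=
  [\/ forall w, e w u -> w = v, forall w, e w v -> w = u | twins u v].

Lemma twins_sym u v : twins u v -> twins v u.
Proof. by move=> uv w wv wu; rewrite uv. Qed.

Lemma inseparable_sym u v : inseparable u v -> inseparable v u.
Proof.
by case=> H; [apply: Or32 | apply: Or31 | apply: Or33; apply: twins_sym].
Qed.

Lemma dominatingP D :
  reflect (forall v, v \notin D -> exists2 u, u \in D & e u v) (dominating e D).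
Proof.
apply: (iffP forallP) => domD v.
  by move=> vD; have /existsP[u /andP[uD euv]] := implyP (domD v) vD; exists u.
by apply/implyP=> /domD[u uD euv]; apply/existsP; exists u; rewrite uD.
Qed.

(** Domination gives [u] and [v] in-neighbours in [D], hence outside the pair, against the first two
    clauses; twins outside [D] would have equal traces on [D]. *)
Lemma locating_dominating_separates D u v :
  locating_dominating e D -> u \notin D -> v \notin D -> u != v ->
  ~ inseparable u v.
Proof.
case/andP=> /dominatingP domD /forallP/(_ u)/forallP/(_ v) locD uD vD uv.
case=> [sub | sub | tw].
- by have [w wD /sub wv] := domD u uD; rewrite -wv wD in vD.
- by have [w wD /sub wu] := domD v vD; rewrite -wu wD in uD.
have /negP[] := implyP locD (introT and3P (And3 uD vD uv)).
apply/eqP/setP=> w; rewrite !inE; case wD: (w \in D); rewrite ?andbF ?andbT //.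
by apply: tw; apply: contraTneq wD => ->.
Qed.

Hypothesis e_irr : irreflexive e.

Lemma arc_neq u v : e u v -> u != v.
Proof. by apply: contraTneq => ->; rewrite e_irr. Qed.

Lemma locating_dominatingC1 u v :
  e u v -> locating_dominating e (~: [set v]).
Proof.
move=> euv; apply/andP; split.
  apply/dominatingP=> x; rewrite !inE negbK => /eqP->.
  by exists u => //; rewrite !inE arc_neq.
apply/forallP=> x; apply/forallP=> y; apply/implyP; rewrite !inE !negbK.
by case/and3P=> /eqP-> /eqP->; rewrite eqxx.
Qed.

Lemma locating_dominatingC2 u v :
  u != v -> ~ inseparable u v -> locating_dominating e (~: [set u; v]).
Proof.
move=> uv sep.
have dom x y : x != y -> ~ (forall w, e w x -> w = y) ->
    exists2 w, (w != x) && (w != y) & e w x.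
  move=> xy nsub; case: (pickP [pred w | e w x & w != y]) => [w | none].
    by case/andP=> ewx wy; exists w; rewrite // arc_neq.
  by case: nsub => w ewx; apply/eqP; have := none w; rewrite /= ewx => /negbFE.
have nbhdD : in_nbhd e u :&: ~: [set u; v] != in_nbhd e v :&: ~: [set u; v].
  apply/eqP=> /setP nbhdE; apply: sep; apply: Or33 => w wu wv.
  by have := nbhdE w; rewrite !inE negb_or wu wv !andbT.
apply/andP; split.
  apply/dominatingP=> x; rewrite !inE negbK => /orP[] /eqP->.
    have [|w wuv ewu] := dom u v uv.
      by move=> sub; apply: sep; apply: Or31.
    by exists w; rewrite // !inE negb_or.
  have [||w wvu ewv] := dom v u; first by rewrite eq_sym.
    by move=> sub; apply: sep; apply: Or32.
  by exists w; rewrite // !inE negb_or andbC.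
apply/forallP=> x; apply/forallP=> y; apply/implyP; rewrite !inE !negbK.
case/and3P=> /orP[] /eqP-> /orP[] /eqP->; rewrite ?eqxx // => _.
by rewrite eq_sym.
Qed.

Hypothesis no_isolated : forall u, exists v, e u v || e v u.

(** An arc yields a locating-dominating set omitting one vertex; a smaller value means that some
    such set omits a pair, which is then not inseparable. *)
Lemma gammaL_pred :
  0 < #|T| ->
  gammaL e = #|T| - 1 <-> (forall u v, u != v -> inseparable u v).
Proof.
move=> /card_gt0P[x0 _]; have [[D0 ldD0 cardD0] min] := gammaLP e.
have [u0 [v0 euv0]] : exists u v, e u v.
  by have [y /orP[] exy] := no_isolated x0; do 2!eexists; exact: exy.
split=> [gE u v uv | insep].
  have nC2 : ~ locating_dominating e (~: [set u; v]).
    move/min; rewrite gE -(cardsC [set u; v]) cards2 uv.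
    by rewrite addSn add1n subn1 /= ltnn.
  (* The clauses of [inseparable] live in [Prop]; finiteness of [T] makes them decidable. *)
  have dec (P : pred T) y :
      (forall w, P w -> w = y) \/ ~ (forall w, P w -> w = y).
    have [/forallP h | /forallPn[w]] := boolP [forall w, P w ==> (w == y)].
      by left=> w Pw; apply/eqP/(implyP (h w)).
    by rewrite negb_imply => /andP[Pw /eqP wy]; right=> /(_ w Pw).
  have [sub|nsub1] := dec (e^~ u) v; first exact: Or31.
  have [sub|nsub2] := dec (e^~ v) u; first exact: Or32.
  have [/forallP h | /forallPn[w]] :=
    boolP [forall w, (w != u) && (w != v) ==> (e w u == e w v)].
    by apply: Or33 => w wu wv; apply/eqP/(implyP (h w)); rewrite wu.
  rewrite negb_imply => /andP[/andP[wu wv] /eqP ewuv].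
  by case: nC2; apply: locating_dominatingC2 => // -[//|//|/(_ w wu wv)].
apply/eqP; rewrite eqn_leq; apply/andP; split.
  have := min _ (locating_dominatingC1 _ _ euv0).
  by rewrite -(cardsC [set v0]) cards1 addKn.
rewrite -cardD0 -(cardsC D0) leq_subLR addnC leq_add2r.
apply/card_le1_eqP=> u v; rewrite !inE => uD vD; apply/eqP/negPn/negP=> uv.
exact: (locating_dominating_separates _ _ _ ldD0 vD uD uv (insep v u uv)).
Qed.

(** * Order three, stars and layered digraphs *)

(** Unless [u] and [v] are twins, the third vertex has an arc to exactly one of them; the other has
    in-neighbours only within the pair. *)
Lemma card3_inseparable u v : #|T| = 3 -> u != v -> inseparable u v.
Proof.
move=> T3 uv.
have third x y : x \in ~: [set u; v] -> y \in ~: [set u; v] -> x = y.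
  move=> xD yD; apply: (card_le1_eqP _ y x yD xD).
  by rewrite -(leq_add2l #|[set u; v]|) cardsC cards2 uv T3.
have [w /and3P[wu wv ne] | eq_uv] :=
  pickP [pred w | [&& w != u, w != v & e w u != e w v]]; last first.
  apply: Or33 => w wu wv; apply/eqP.
  by have := eq_uv w; rewrite /= wu wv => /negbFE.
have only x : x != u -> x != v -> x = w.
  by move=> xu xv; apply: third; rewrite !inE negb_or ?xu ?wu.
case ewu: (e w u) ne => /= ne; [apply: Or32 | apply: Or31] => x ex.
  apply/eqP/negPn/negP=> xu; have xw := only x xu (arc_neq _ _ ex).
  by move: ne; rewrite -xw ex.
apply/eqP/negPn/negP=> xv; have xw := only x (arc_neq _ _ ex) xv.
by rewrite -xw ex in ewu.
Qed.

(** A vertex other than the centre has at most the centre as in-neighbour, so two of them are twins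
    unless one is a source. *)
Lemma star_inseparable u v :
  directed_star e -> u != v -> inseparable u v.
Proof.
case=> -[c cP] _ uv.
have [uc | uc] := eqVneq u c.
  apply: Or32 => w /cP[-> // | vc]; by rewrite uc vc eqxx in uv.
have [vc | vc] := eqVneq v c.
  by apply: Or31 => w /cP[-> // | /eqP]; rewrite (negPf uc).
have inc x w : x != c -> e w x -> w = c.
  by move=> xc /cP[// | /eqP]; rewrite (negPf xc).
case ecu: (e c u); last by apply: Or31 => w eu; rewrite -(inc u w) ?eu in ecu.
case ecv: (e c v); last by apply: Or32 => w ev; rewrite -(inc v w) ?ev in ecv.
apply: Or33 => w _ _; apply/idP/idP => [/(inc _ _ uc)-> | /(inc _ _ vc)->] //.
Qed.

(** Vertices of [S1] are sources; any other vertex has as in-neighbours exactly the vertices outside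
    [S2] other than itself, so two of these are twins. *)
Lemma layered_inseparable (S1 C S2 : {set T}) u v :
  tripartition S1 C S2 -> layered e S1 C S2 -> u != v -> inseparable u v.
Proof.
move=> [cover dS1C dS1S2 dCS2] [iS1 iS2 kC arcs] uv.
have part x : [|| x \in S1, x \in C | x \in S2].
  by have /setP/(_ x) := cover; rewrite !inE orbA => ->.
have S1NC x : x \in S1 -> x \in C = false by exact: (disjointFr dS1C).
have S1NS2 x : x \in S1 -> x \in S2 = false by exact: (disjointFr dS1S2).
have CNS2 x : x \in C -> x \in S2 = false by exact: (disjointFr dCS2).
have CNS1 x : x \in C -> x \in S1 = false by exact: (disjointFl dS1C).
have S2NS1 x : x \in S2 -> x \in S1 = false by exact: (disjointFl dS1S2).
have S2NC x : x \in S2 -> x \in C = false by exact: (disjointFl dCS2).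
have inS1 x : x \in S1 -> forall w, e w x = false.
  move=> xS1 w; case wS1: (w \in S1); first exact: negbTE (iS1 _ _ wS1 xS1).
  by rewrite arcs ?inE wS1 (S1NC _ xS1) (S1NS2 _ xS1) !andbF.
have inNS1 x w : x \notin S1 -> w != x -> e w x = (w \notin S2).
  move=> xNS1 wx; have := part x; rewrite (negPf xNS1) /= => xCS2.
  case/or3P: (part w) => hw.
  - rewrite arcs ?inE hw ?(S1NC _ hw) ?(S1NS2 _ hw) ?(negPf xNS1) //=.
    by rewrite orbF.
  - rewrite (CNS2 _ hw); case/orP: xCS2 => hx; first by rewrite kC.
    by rewrite arcs ?inE hw ?hx ?(CNS2 _ hw) ?(CNS1 _ hw) ?(S2NC _ hx).
  - rewrite hw; case/orP: xCS2 => hx; last exact: negbTE (iS2 _ _ hw hx).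
    by rewrite arcs ?inE ?hw ?hx ?(S2NC _ hw) ?(S2NS1 _ hw) ?(CNS2 _ hx).
have [uS1 | uS1] := boolP (u \in S1); first by apply: Or31 => w; rewrite inS1.
have [vS1 | vS1] := boolP (v \in S1); first by apply: Or32 => w; rewrite inS1.
by apply: Or33 => w wu wv; rewrite !inNS1.
Qed.

(** * Classification when all pairs are inseparable *)

Lemma twins_layered :
  (forall u v x y, u != v -> e x u -> e y v -> twins u v) ->
  exists S1 C S2 : {set T}, tripartition S1 C S2 /\ layered e S1 C S2.
Proof.
move=> tw.
pose Q := [set v | [exists u, e u v]].
have QP v : reflect (exists u, e u v) (v \in Q).
  by rewrite inE; apply: existsP.
have headQ u v : e u v -> v \in Q by move=> euv; apply/QP; exists u.
pose K := [set w | [forall v in Q, (v != w) ==> e w v]].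
have KP w v : w \in K -> v \in Q -> v != w -> e w v.
  by rewrite inE => /forall_inP wK vQ vw; apply: (implyP (wK v vQ)).
(* Since vertices of [Q] are twins, one out-neighbour of [w] forces arcs from [w] to all other
   vertices of [Q]. *)
have tailK w v : e w v -> w \in K.
  move=> ewv; rewrite inE; apply/forall_inP=> x xQ; apply/implyP=> xw.
  have [-> // | xv] := eqVneq x v; have [y eyx] := QP _ xQ.
  rewrite eq_sym in xw.
  by rewrite (tw _ _ _ _ xv eyx ewv w xw (arc_neq _ _ ewv)).
have sourceK w : w \notin Q -> w \in K.
  move=> wQ; have [v /orP[/tailK // | /headQ]] := no_isolated w.
  by rewrite (negPf wQ).
have mem := (in_setI, in_setC, in_setD, in_setU, in_set0, in_setT).
(* Sources form [S1]; [K] splits the rest, and vertices outside [K] have no out-neighbours. *)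
exists (~: Q), (Q :&: K), (Q :\: K); split; split.
- by apply/setP=> x; rewrite !mem; case: (x \in Q); case: (x \in K).
- by rewrite -setI_eq0; apply/eqP/setP=> x; rewrite !mem;
    case: (x \in Q); case: (x \in K).
- by rewrite -setI_eq0; apply/eqP/setP=> x; rewrite !mem;
    case: (x \in Q); case: (x \in K).
- by rewrite -setI_eq0; apply/eqP/setP=> x; rewrite !mem;
    case: (x \in Q); case: (x \in K).
- by move=> u v _; rewrite in_setC; apply: contra => /headQ.
- by move=> u v; rewrite in_setD => /andP[uK _] _; apply: contra uK => /tailK.
- move=> u v; rewrite !in_setI => /andP[_ uK] /andP[vQ _] uv.
  by apply: KP; rewrite // eq_sym.
move=> u v; rewrite in_setU !in_setC !in_setI !in_setD => nin.
(* All arcs go from [K] to [Q] and sources lie in [K], so the clause reduces to a boolean check. *)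
have eE : e u v = [&& u \in K, v \in Q & v != u].
  apply/idP/and3P=> [euv | [uK vQ vu]]; last exact: KP.
  by rewrite (tailK _ _ euv) (headQ _ _ euv) eq_sym arc_neq.
have vu : v != u.
  apply: contraNneq nin => ->; by case: (u \in Q); case: (u \in K).
have : (u \in Q) || (u \in K) by case: (boolP (u \in Q)) => //= /sourceK.
rewrite eE vu; move: nin.
by case: (u \in Q); case: (v \in Q); case: (u \in K); case: (v \in K).
Qed.

Lemma star_or_card3 a c w :
  (forall u v, u != v -> inseparable u v) ->
  e c a -> (forall x, e x a -> x = c) -> e w c -> w != a ->
  #|T| = 3 \/ directed_star e.
Proof.
move=> insep eca ina ewc wa.
have ca := arc_neq _ _ eca; have wc := arc_neq _ _ ewc.
(* Compare [x] with [a]: the in-neighbour [c] of [a] is not [x], and a twin of [a] has no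
   in-neighbours besides [a] and [c]. *)
have in_ac x y : x != a -> x != c -> e y x -> y = a \/ y = c.
  move=> xa xc eyx; have [-> | ya] := eqVneq y a; [by left | right].
  case: (insep x a xa) => [sub | sub | tw].
  - by rewrite (sub y eyx) eqxx in ya.
  - by rewrite (sub c eca) eqxx in xc.
  - by apply: ina; rewrite -tw // arc_neq.
have [x /and3P[xa xc eax] | none] :=
  pickP [pred x | [&& x != a, x != c & e a x]]; last first.
  right; split=> //; exists c => u v euv.
  have [vc | vc] := eqVneq v c; first by right.
  have [va | va] := eqVneq v a; first by left; apply: ina; rewrite -va.
  case: (in_ac v u va vc euv) => [ua | ->]; last by left.
  by have := none v; rewrite /= va vc -ua euv.
(* Compare [c] with [y]: if they are twins, an in-neighbour [z] of [c] other than [y] is also one of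
   [y], and [in_ac] leaves only [a]. *)
have inc y z : y != a -> y != c -> e a y -> e z c -> z = a \/ z = y.
  move=> ya yc eay ezc; have [-> | zy] := eqVneq z y; [by right | left].
  case: (insep y c yc) => [sub | sub | tw].
  - by rewrite (sub a eay) eqxx in ca.
  - by rewrite (sub z ezc) eqxx in zy.
  - have zc := arc_neq _ _ ezc; have : e z y by rewrite tw.
    by case/(in_ac _ _ ya yc) => // /eqP; rewrite (negPf zc).
have wE y : y != a -> y != c -> e a y -> w = y.
  move=> ya yc eay; case: (inc y w ya yc eay ewc) => // /eqP.
  by rewrite (negPf wa).
have all3 y : [|| y == a, y == c | y == x].
  apply/negPn/negP; rewrite !negb_or => /and3P[ya yc yx].
  have nay : e a y = false.
    by apply/negP=> /(wE y ya yc) wy; rewrite -(wE x xa xc eax) wy eqxx in yx.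
  (* A fourth vertex [y] has no out-neighbour, since any head would force [y] to be [a], [c] or [x].
     Not being isolated, it has in-neighbour [c]. *)
  have ecy : e c y.
    have [z /orP[eyz | ezy]] := no_isolated y; last first.
      by case: (in_ac y z ya yc ezy) => [za | <- //]; rewrite -za ezy in nay.
    have [za | za] := eqVneq z a.
      by rewrite za in eyz; rewrite (ina y eyz) eqxx in yc.
    have [zc | zc] := eqVneq z c.
      rewrite zc in eyz.
      by case: (inc x y xa xc eax eyz) => yE; rewrite yE eqxx in ya yx.
    by case: (in_ac z y za zc eyz) => yE; rewrite yE eqxx in ya yc.
  (* Of [x] and [y], [a] has an arc to [x] only, while [c] has one to [y]: no clause can hold. *)
  case: (insep x y) => [|sub|sub|tw]; first by rewrite eq_sym.
  - by rewrite (sub a eax) eqxx in ya.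
  - by rewrite (sub c ecy) eqxx in xc.
  - by move: nay; rewrite -tw ?eax // eq_sym.
left; have <- : #|[set a; c; x]| = 3.
  rewrite -setUA cardsU1 cards2 !inE negb_or.
  by rewrite (eq_sym a) ca (eq_sym a) xa (eq_sym c) xc.
by apply/esym/eq_card=> y; rewrite !inE -orbA all3.
Qed.

(** Either a triple [a], [c], [w] as in [star_or_card3] exists, or inseparable vertices of positive
    in-degree are twins. *)
Lemma inseparable_classification :
  (forall u v, u != v -> inseparable u v) ->
  [\/ #|T| = 3, directed_star e
    | exists S1 C S2 : {set T}, tripartition S1 C S2 /\ layered e S1 C S2].
Proof.
move=> insep.
have [/existsP[[[a c] w] /= /and4P[eca /forallP ina ewc wa]] | none] :=
  boolP [exists t : T * T * T, let: (a, c, w) := t in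
    [&& e c a, [forall x, e x a ==> (x == c)], e w c & w != a]].
  have [||] := star_or_card3 a c w insep eca _ ewc wa; last by apply: Or32.
  - by move=> x exa; apply/eqP/(implyP (ina x)).
  - exact: Or31.
apply: Or33; apply: twins_layered.
(* If [v], the only in-neighbour of [u], had an in-neighbour [w] other than [u], then [(u, v, w)]
   would be such a triple. *)
have half u v x : e x u -> (forall w, e w u -> w = v) -> twins u v.
  move=> exu sub w wu wv.
  have -> : e w u = false by apply: contraNF wv => /sub->.
  apply/esym/negP=> ewv; case/negP: none; apply/existsP; exists (u, v, w).
  rewrite /= ewv wu -{1}(sub x exu) exu /= andbT.
  by apply/forallP=> z; apply/implyP=> /sub->.
move=> u v x y uv exu eyv; case: (insep u v uv) => [sub | sub | //].
  exact: half exu sub.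
by apply: twins_sym; apply: half eyv sub.
Qed.

End LocatingDomination.

(** * The characterization for connected digraphs *)

(** A path from [u] to another vertex starts with an arc at [u]. *)
Lemma weakly_connected_no_isolated (T : finType) (e : rel T) :
  weakly_connected e -> 2 <= #|T| -> forall u, exists v, e u v || e v u.
Proof.
move=> conn T2 u.
have /set0Pn[v] : [set~ u] != set0.
  by rewrite -card_gt0 -(ltn_add2l #|[set u]|) cardsC cards1.
rewrite !inE => vu.
have /connectP[[|x p] /= path_p vE] := conn u v; first by rewrite vE eqxx in vu.
by exists x; case/andP: path_p.
Qed.

Theorem theorem6 (T : finType) (e : rel T) (e_irr : irreflexive e)
    (e_conn : weakly_connected e) (n_ge2 : 2 <= #|T|) :
  gammaL e = #|T| - 1 <->
  [\/ #|T| = 3,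
      directed_star e
    | exists S1 C S2 : {set T}, tripartition S1 C S2 /\ layered e S1 C S2].
Proof.
have no_iso := weakly_connected_no_isolated T e e_conn n_ge2.
apply: iff_trans (gammaL_pred T e e_irr no_iso (ltnW n_ge2)) _.
split=> [|cases u v uv]; first exact: inseparable_classification.
case: cases => [T3 | star | [S1 [C [S2 [part lay]]]]].
- exact: card3_inseparable.
- exact: star_inseparable.
- exact: layered_inseparable part lay uv.
Qed.
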